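(* Let $x^* \in \operatorname{dom} f$ be a point of local minimum of the problem $$\min f(x) \quad \text{subject to} \quad y_0 \in \Phi(x), \quad x \in A,$$ let $f$ be Lipschitz continuous near $x^*$, and let $\Phi$ be metrically subregular with respect to the set $A$ at $(x^*, y_0)$. Let $\alpha > 0$ be the exponent in the definition of $g$ and $F_\lambda$ given in the context. Suppose that: (1) $\phi(t) \ge \phi_0 t^{\gamma}$ for all $t \in [0,t_0]$, for some $\phi_0 > 0$, $\gamma > 0$ and $t_0 > 0$; (2) $\beta(\mu) \ge \beta_0 \mu^{\sigma}$ for all $\mu \in [0,\overline{\mu}]$, for some $\beta_0 > 0$, $\sigma > 0$ and $\overline{\mu} > 0$. Suppose also that $$\gamma > \frac{1}{2}, \qquad \sigma \le \frac{\alpha}{2\gamma - 1}.$$ Then the penalty function $F_\lambda(x,\mu)$ is exact at $x^*$.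
   Context: Setting. Let $X$ and $Y$ be metric spaces (both metrics denoted $d$), $A \subset X$ a nonempty set, $\Phi \colon X \rightrightarrows Y$ a set-valued mapping with closed images, $y_0 \in Y$, and $f \colon X \to \mathbb{R} \cup \{+\infty\}$ with $\operatorname{dom} f = \{x \in X \mid f(x) < +\infty\}$. Write $\mathbb{R}_+ = [0,+\infty)$, $d(x_0,C) = \inf_{x \in C} d(x_0,x)$ for the distance from a point to a set (equal to $+\infty$ if $C = \emptyset$), and $\Phi^{-1}(y) = \{x \in X \mid y \in \Phi(x)\}$. The feasible set of the problem is $\Omega = \Phi^{-1}(y_0) \cap A$, assumed nonempty, and $f$ is assumed bounded below on $\Omega$. A point of local minimum of the problem is a point $x^* \in \Omega$ such that $f(x) \ge f(x^* )$ for all $x \in \Omega$ in some neighbourhood of $x^*$. Let $\phi \colon \mathbb{R}_+ \cup \{+\infty\} \to \mathbb{R}_+ \cup \{+\infty\}$ be non-decreasing with $\phi(t) = 0$ iff $t = 0$, let $\beta \colon \mathbb{R}_+ \to \mathbb{R}_+ \cup \{+\infty\}$ be non-decreasing with $\beta(\mu) = 0$ iff $\mu = 0$, and let $\alpha > 0$. Define, for $x \in X$ and $\mu \in \mathbb{R}_+$, $$g(x,\mu) = \begin{cases} f(x), & x \in \Omega,\ \mu = 0, \\ +\infty, & x \notin \Omega,\ \mu = 0, \\ f(x) + \frac{1}{\mu^{\alpha}}\,\phi\big(d(y_0,\Phi(x))^2\big), & \mu > 0, \end{cases} \qquad F_\lambda(x,\mu) = g(x,\mu) + \lambda \beta(\mu),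 \quad \lambda \ge 0,$$ with the convention $0 \cdot (+\infty) = 0$. Exactness: for a point of local minimum $x^* \in \operatorname{dom} f$ of the problem, $F_\lambda$ is called (locally) exact at $x^*$ if there exists $\lambda \ge 0$ such that $(x^*,0)$ is a point of local minimum of $F_\lambda$ on $A \times \mathbb{R}_+$. Metric subregularity: $\Phi$ is metrically subregular with respect to $A$ at $(\overline{x},\overline{y})$, where $\overline{x} \in A$ and $\overline{y} \in \Phi(\overline{x})$, if there exist $a > 0$ and a neighbourhood $U$ of $\overline{x}$ such that $d(\overline{y},\Phi(x)) \ge a\, d(x, \Phi^{-1}(\overline{y}) \cap A)$ for all $x \in U \cap A$. ''Lipschitz continuous near $x^*$'' means that $f$ is real-valued and Lipschitz continuous on some neighbourhood of $x^*$. *)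

(* Defs.v *)
From mathcomp Require Import all_boot all_order all_algebra.
From mathcomp Require Import all_classical all_reals all_analysis.
Set Implicit Arguments.
Unset Strict Implicit.
Unset Printing Implicit Defensive.
Import Order.TTheory GRing.Theory Num.Theory.
Import numFieldNormedType.Exports.
Local Open Scope classical_set_scope.
Local Open Scope ring_scope.

(* Equal to [+oo] when [C] is empty. *)
Definition dist_to (R : realType) (X : metricType R) (x0 : X) (C : set X) :
    \bar R :=
  ereal_inf [set (mdist x0 x)%:E | x in C].

(* A set-valued mapping [X => Y] is encoded as [Phi : X -> set Y]. *)
Definition inv_image (X Y : Type) (Phi : X -> set Y) (y : Y) : set X :=
  [set x | Phi x y].

Definition feasible (X Y : Type) (A : set X) (Phi : X -> set Y) (y0 : Y) :
    set X :=
  inv_image Phi y0 `&` A.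

Definition local_min (R : realType) (T : topologicalType) (S : set T)
    (h : T -> \bar R) (z : T) : Prop :=
  S z /\ \forall x \near z, S x -> (h z <= h x)%E.

Definition lipschitz_near (R : realType) (X : metricType R) (f : X -> \bar R)
    (x0 : X) : Prop :=
  exists2 U : set X, nbhs x0 U &
    (forall u, U u -> f u \is a fin_num) /\
    exists2 L : R, 0 <= L &
      forall u v, U u -> U v ->
        `|fine (f u) - fine (f v)| <= L * mdist u v.

Definition metrically_subregular (R : realType) (X Y : metricType R)
    (Phi : X -> set Y) (A : set X) (xbar : X) (ybar : Y) : Prop :=
  [/\ A xbar, Phi xbar ybar &
    exists2 a : R, 0 < a &
      exists2 U : set X, nbhs xbar U &
        forall x, U x -> A x ->
          (a%:E * dist_to x (inv_image Phi ybar `&` A)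
            <= dist_to ybar (Phi x))%E].

(* Functions on [R_+ u {+oo}] and on [R_+] are encoded as functions on all of
   [\bar R] and [R]; only their values at nonnegative arguments are ever
   constrained or used. *)
Definition phi_admissible (R : realType) (phi : \bar R -> \bar R) : Prop :=
  [/\ forall t, (0 <= t)%E -> (0 <= phi t)%E,
      forall s t, (0 <= s)%E -> (s <= t)%E -> (phi s <= phi t)%E &
      forall t, (0 <= t)%E -> (phi t = 0%E <-> t = 0%E)].

Definition beta_admissible (R : realType) (beta : R -> \bar R) : Prop :=
  [/\ forall mu, 0 <= mu -> (0 <= beta mu)%E,
      forall mu nu, 0 <= mu -> mu <= nu -> (beta mu <= beta nu)%E &
      forall mu, 0 <= mu -> (beta mu = 0%E <-> mu = 0)].

(* Meaningful for [0 <= mu] only. *)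
Definition smooth_g (R : realType) (X Y : metricType R) (A : set X)
    (Phi : X -> set Y) (y0 : Y) (f : X -> \bar R) (phi : \bar R -> \bar R)
    (alpha : R) (x : X) (mu : R) : \bar R :=
  if mu == 0 then (if x \in feasible A Phi y0 then f x else +oo%E)
  else (f x + ((mu `^ alpha)^-1)%:E * phi (dist_to y0 (Phi x) ^+ 2))%E.

(* The library's product on [\bar R] satisfies [0 * +oo = 0]. *)
Definition penalty (R : realType) (X Y : metricType R) (A : set X)
    (Phi : X -> set Y) (y0 : Y) (f : X -> \bar R) (phi : \bar R -> \bar R)
    (beta : R -> \bar R) (alpha lambda : R) (x : X) (mu : R) : \bar R :=
  (smooth_g A Phi y0 f phi alpha x mu + lambda%:E * beta mu)%E.

Definition locally_exact (R : realType) (X Y : metricType R) (A : set X)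
    (Phi : X -> set Y) (y0 : Y) (f : X -> \bar R) (phi : \bar R -> \bar R)
    (beta : R -> \bar R) (alpha : R) (xs : X) : Prop :=
  exists2 lambda : R, 0 <= lambda &
    local_min (A `*` [set mu : R | 0 <= mu])
      (fun z : X * R => penalty A Phi y0 f phi beta alpha lambda z.1 z.2)
      (xs, 0).

(* Main.v *)
Require Import Defs.
From mathcomp Require Import all_boot all_order all_algebra.
From mathcomp Require Import all_classical all_reals all_analysis.
From mathcomp Require Import ring lra.
Import Order.TTheory GRing.Theory Num.Theory.
Import numFieldNormedType.Exports.
Local Open Scope classical_set_scope.
Local Open Scope ring_scope.

(** Why the theorem is true.  Two effects compete when [x] leaves
    the feasible set [S] at distance [D]: the Lipschitz bound allows [f] to drop
    by at most [L * D] below its local minimum over [S]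
    ([local_min_dist_penalty]), while metric subregularity forces the
    constraint violation [dist_to y0 (Phi x)] to be at least [s = a * D].
    Since [phi] is monotone with [phi t >= phi0 * t `^ gamma] near zero, the
    penalty term is at least [phi0 * s `^ (2 * gamma) / mu `^ alpha], and it
    remains to see that this, together with a multiple of [mu `^ sigma], absorbs
    the loss [(L / a) * s].

    That is a statement about real numbers ([power_tradeoff]), in which the
    exponents play their part.  The penalty term, of exponent
    [2 * gamma > 1] in [s], beats a linear loss exactly when [s] is at least a
    multiple of [mu `^ (alpha / (2 * gamma - 1))].  For smaller [s] the linear
    loss is itself at most a multiple of that power of [mu], hence of
    [mu `^ sigma] because [mu <= 1] and [sigma <= alpha / (2 * gamma - 1)]; a
    large enough multiple of [beta mu] compensates it. *)

(** * Distance to a set *)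

Lemma dist_to_ge0 (R : realType) (X : metricType R) (x : X) (S : set X) :
  (0 <= dist_to x S)%E.
Proof.
by apply/ereal_infP => _ [w _ <-]; rewrite lee_fin mdist_ge0.
Qed.

Lemma dist_to_le (R : realType) (X : metricType R) (x w : X) (S : set X) :
  S w -> (dist_to x S <= (mdist x w)%:E)%E.
Proof. by move=> Sw; apply: ereal_inf_lbound; exists w. Qed.

Lemma dist_to_fin_num (R : realType) (X : metricType R) (x w : X) (S : set X) :
  S w -> dist_to x S \is a fin_num.
Proof.
move=> Sw; rewrite ge0_fin_numE ?dist_to_ge0//.
exact: le_lt_trans (dist_to_le _ _ x _ _ Sw) (ltry _).
Qed.

(** Any [w] in [S] gives [f z <= f x + L * mdist x w].  If [w] is close to [z]
    this is the minimality of [z] at [w] combined with the Lipschitz bound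
    between [w] and [x].  If [w] is far from [z] and [x] is near [z], then [w]
    is at least as far from [x] as [z] is, and the Lipschitz bound between [z]
    and [x] suffices. *)
Lemma local_min_dist_penalty (R : realType) (X : metricType R) (S : set X)
    (f : X -> \bar R) (z : X) :
  local_min S f z -> lipschitz_near f z ->
  exists2 L : R, 0 < L &
    \forall x \near z, (f z <= f x + L%:E * dist_to x S)%E.
Proof.
move=> [Sz zmin] [U Uz [Ufin [L0 L0ge0 Ulip]]].
(* The Lipschitz constant may be zero; it is increased so that one can divide
   by it. *)
pose L := L0 + 1; have Lgt0 : 0 < L by rewrite ltr_wpDl.
exists L => //.
have /nbhs_ballP[e /= e0 eW] : \forall x \near z, U x /\ (S x -> (f z <= f x)%E).
  exact: filterI.
have lip u v : U u -> U v -> fine (f u) <= fine (f v) + L * mdist u v.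
  move=> Uu Uv; have := Ulip u v Uu Uv.
  have := mdist_ge0 u v; have := ler_norm (fine (f u) - fine (f v)).
  by rewrite /L mulrDl mul1r; lra.
have Uz' : U z by exact: nbhs_singleton.
apply/nbhs_ballP; exists (e / 2) => /=; first by lra.
move=> x; rewrite ballEmdist /= => zx.
have Ux : U x by apply: (eW x _).1; rewrite ballEmdist /=; lra.
(* By homogeneity it suffices to bound the distance itself from below. *)
suff : (((fine (f z) - fine (f x)) / L)%:E <= dist_to x S)%E.
  rewrite -(fineK (Ufin _ Uz')) -(fineK (Ufin _ Ux)).
  rewrite -(fineK (dist_to_fin_num _ _ x _ _ Sz)) -EFinM -EFinD !lee_fin /=.
  by rewrite ler_pdivrMr// => h; rewrite mulrC; lra.
apply/ereal_infP => _ [w Sw <-]; rewrite lee_fin ler_pdivrMr// mulrC.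
have [zw|zw] := ltP (mdist z w) e.
  have [Uw fw] : U w /\ (S w -> (f z <= f w)%E).
    by apply: eW; rewrite ballEmdist.
  have := fw Sw; rewrite -(fineK (Ufin _ Uz')) -(fineK (Ufin _ Uw)) lee_fin.
  by have := lip w x Uw Ux; rewrite (metric_sym w x); lra.
have le_zx_xw : mdist z x <= mdist x w by have := metric_triangle z x w; lra.
have := lip z x Uz' Ux; have := ler_wpM2l (ltW Lgt0) le_zx_xw; lra.
Qed.

(** * The competition between the powers of the parameter *)

(** The threshold [s = K0 * mu `^ (alpha / (p - 1))] is where [c * s] and
    [k * s `^ p / mu `^ alpha] balance: above it the second term is the larger
    one, below it [c * s] is at most [c * K0 * mu `^ sigma]. *)
Lemma power_tradeoff (R : realType) (c k p sigma alpha : R) :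
  0 < c -> 0 < k -> 1 < p -> sigma <= alpha / (p - 1) ->
  exists2 K : R, 0 <= K & forall s mu, 0 <= s -> 0 < mu <= 1 ->
    c * s <= (mu `^ alpha)^-1 * (k * s `^ p) + K * mu `^ sigma.
Proof.
move=> c0 k0 p1 sigma_le; have p10 : 0 < p - 1 by lra.
pose K0 := (c / k) `^ (p - 1)^-1; have K0ge0 : 0 <= K0 by exact: powR_ge0.
have K0p : K0 `^ (p - 1) = c / k.
  by rewrite /K0 -powRrM mulVf ?gt_eqF// powRr1// divr_ge0// ltW.
exists (c * K0); first by rewrite mulr_ge0// ltW.
move=> s mu s0 mu01; have /andP[mu0 mu1] := mu01.
have mua : 0 < mu `^ alpha by exact: powR_gt0.
set r := alpha / (p - 1).
have mur : mu `^ r <= mu `^ sigma by exact: ger_powR.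
have penalty_ge0 : 0 <= (mu `^ alpha)^-1 * (k * s `^ p).
  by rewrite mulr_ge0 ?invr_ge0 ?mulr_ge0 ?powR_ge0 ?ltW.
have [small|large] := leP s (K0 * mu `^ r).
  have : c * s <= c * (K0 * mu `^ sigma).
    by rewrite ler_wpM2l ?(ltW c0)// (le_trans small)// ler_wpM2l.
  by rewrite mulrA; lra.
have s_powR : c / k * mu `^ alpha <= s `^ (p - 1).
  have -> : c / k * mu `^ alpha = (K0 * mu `^ r) `^ (p - 1).
    by rewrite powRM ?powR_ge0// K0p -powRrM /r divfK ?gt_eqF.
  by apply: ge0_ler_powR; rewrite ?nnegrE ?mulr_ge0 ?powR_ge0 ?(ltW large)// ltW.
have : c * s <= (mu `^ alpha)^-1 * (k * s `^ p).
  rewrite ler_pdivlMl// -(mulr_powRB1 s0); last by lra.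
  have := ler_wpM2l (mulr_ge0 (ltW k0) s0) s_powR.
  suff -> : k * s * (c / k * mu `^ alpha) = mu `^ alpha * (c * s).
    by rewrite -[k * s * s `^ _]mulrA.
  by field; rewrite gt_eqF.
have : 0 <= c * K0 * mu `^ sigma by rewrite !mulr_ge0 ?powR_ge0 ?ltW.
lra.
Qed.

(** * Exactness *)

Theorem theorem5 (R : realType) (X Y : metricType R) (A : set X)
    (Phi : X -> set Y) (y0 : Y) (f : X -> \bar R)
    (phi : \bar R -> \bar R) (beta : R -> \bar R) (alpha : R) (xs : X)
    (phi0 gamma t0 beta0 sigma mubar : R)
    (A_nonempty : A !=set0)
    (Phi_closed : forall x, closed (Phi x))
    (f_proper : forall x, f x != -oo%E)
    (Omega_nonempty : feasible A Phi y0 !=set0)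
    (f_bounded_below : exists c : R,
       forall x, feasible A Phi y0 x -> (c%:E <= f x)%E)
    (phi_adm : phi_admissible phi)
    (beta_adm : beta_admissible beta)
    (alpha_gt0 : 0 < alpha)
    (xs_dom : (f xs < +oo)%E)
    (xs_locmin : local_min (feasible A Phi y0) f xs)
    (f_lipschitz : lipschitz_near f xs)
    (Phi_subregular : metrically_subregular Phi A xs y0)
    (phi0_gt0 : 0 < phi0) (gamma_gt0 : 0 < gamma) (t0_gt0 : 0 < t0)
    (phi_growth : forall t : R, 0 <= t <= t0 ->
       ((phi0 * t `^ gamma)%:E <= phi t%:E)%E)
    (beta0_gt0 : 0 < beta0) (sigma_gt0 : 0 < sigma) (mubar_gt0 : 0 < mubar)
    (beta_growth : forall mu : R, 0 <= mu <= mubar ->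
       ((beta0 * mu `^ sigma)%:E <= beta mu)%E)
    (gamma_gt_half : 1 / 2 < gamma)
    (sigma_le : sigma <= alpha / (2 * gamma - 1)) :
  locally_exact A Phi y0 f phi beta alpha xs.
Proof.
have [xsS _] := xs_locmin.
have [L L0 fz_le] := local_min_dist_penalty _ _ _ _ _ xs_locmin f_lipschitz.
have [_ _ [a a0 [V Vxs Vsub]]] := Phi_subregular.
have [_ phi_homo _] := phi_adm.
have [_ _ beta_eq0] := beta_adm.
have p1 : 1 < 2 * gamma by lra.
have beta_at0 : beta 0 = 0%E by exact: (beta_eq0 0 (lexx 0)).2.
have [K K0 tradeoff] :=
  power_tradeoff _ (L / a) _ _ _ _ (divr_gt0 L0 a0) phi0_gt0 p1 sigma_le.
pose lambda := K / beta0.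
have lambda0 : 0 <= lambda by rewrite divr_ge0// ltW.
exists lambda => //.
have penalty0 : penalty A Phi y0 f phi beta alpha lambda xs 0 = f xs.
  by rewrite /penalty /smooth_g eqxx mem_set// beta_at0// mule0 adde0.
split; first by split => //=; exact: xsS.2.
rewrite /= penalty0.
(* Within this radius the square of [a] times the distance from [x] to the
   feasible set stays below [t0], where the growth of [phi] is known. *)
pose rho := Num.sqrt t0 / a.
have rho0 : 0 < rho by rewrite divr_gt0// sqrtr_gt0.
have near_x : \forall x \near xs,
    [/\ V x, (f xs <= f x + L%:E * dist_to x (feasible A Phi y0))%E,
        feasible A Phi y0 x -> (f xs <= f x)%E & mdist xs x < rho].
  near=> x; split; near: x => //.
  - exact: xs_locmin.2.
  - by apply/nbhs_ballP; exists rho => //= x; rewrite ballEmdist.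
have near_mu : \forall mu \near (0 : R), mu < Num.min 1 mubar.
  by apply: lt_nbhsl; rewrite lt_min ltr01.
(* A product neighbourhood of [(xs, 0)] is given by its two factors. *)
refine (ex_intro2 _ _ (_, _) (conj near_x near_mu) _).
move=> [x mu] /= [[Vx fxs_le xmin xrho]].
rewrite lt_min => /andP[mu_lt1 mu_ltmubar] [Ax mu_ge0].
rewrite /penalty /smooth_g; case: ifPn => [/eqP -> | mu_neq0].
  rewrite beta_at0// mule0 adde0.
  by case: ifPn => [/set_mem/xmin|_] //; rewrite leey.
have mu_gt0 : 0 < mu by rewrite lt_def mu_neq0.
have Dfin := dist_to_fin_num _ _ x _ _ xsS.
pose D := fine (dist_to x (feasible A Phi y0)).
have D0 : 0 <= D by rewrite fine_ge0// dist_to_ge0.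
have D_lt : D < rho.
  rewrite (le_lt_trans _ xrho)// -lee_fin fineK// (metric_sym xs x).
  exact: dist_to_le.
pose s := a * D; have s0 : 0 <= s by rewrite mulr_ge0// ltW.
have s_le : (s%:E <= dist_to y0 (Phi x))%E.
  by rewrite EFinM fineK//; exact: Vsub.
have s2_le : s ^+ 2 <= t0.
  rewrite -[leRHS]sqr_sqrtr ?(ltW t0_gt0)// ler_sqr ?nnegrE ?sqrtr_ge0//.
  by rewrite /s mulrC -ler_pdivlMr// ltW.
have phi_ge : ((phi0 * s `^ (2 * gamma))%:E <= phi (dist_to y0 (Phi x) ^+ 2))%E.
  rewrite powRrM powR_mulrn//.
  apply: le_trans (phi_growth (s ^+ 2) _) _; first by rewrite sqr_ge0.
  apply: phi_homo; first by rewrite lee_fin sqr_ge0.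
  by rewrite EFin_expe lee_sqr ?lee_fin// (le_trans _ s_le) ?lee_fin.
have penalty_ge : (((mu `^ alpha)^-1 * (phi0 * s `^ (2 * gamma)))%:E
    <= ((mu `^ alpha)^-1)%:E * phi (dist_to y0 (Phi x) ^+ 2))%E.
  by rewrite EFinM lee_wpmul2l// lee_fin invr_ge0 powR_ge0.
have lambda_beta_ge : ((K * mu `^ sigma)%:E <= lambda%:E * beta mu)%E.
  have -> : K * mu `^ sigma = lambda * (beta0 * mu `^ sigma).
    by rewrite mulrA divfK ?gt_eqF.
  rewrite EFinM lee_wpmul2l ?lee_fin//.
  by apply: beta_growth; rewrite mu_ge0 ltW.
apply: (le_trans fxs_le); rewrite -addeA leeD2l//.
apply: le_trans (leeD penalty_ge lambda_beta_ge).
rewrite -(fineK Dfin) -EFinM -EFinD lee_fin.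
have -> : L * D = L / a * s by rewrite /s mulrA divfK ?gt_eqF.
by apply: tradeoff => //; rewrite mu_gt0 ltW.
Unshelve. all: by end_near.
Qed.
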